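(* Let $\mathcal{F}$ be a basis of $\mathbb{Q}_p^d$, let $n\ge 1$, and let $\alpha_1,\ldots,\alpha_n$ be vertices of $\mathscr{B}=\mathscr{B}(\mathrm{SL}_d(\mathbb{Q}_p))$ with matrix representatives $\alpha_i=(A_i)_v$ with respect to $\mathcal{F}$, $A_i\in\mathrm{GL}_d(\mathbb{Q}_p)$. Then $$\min_{\beta\in\mathscr{B}^0}\Big\{\sum_{i=1}^n\delta(\alpha_i,\beta)\Big\}\ \geq\ \max_{\pi\in S_n}\Big\{\sum_{i=1}^n\Big(m_{A_i:d}^{A_{\pi(i)}:0}-m_{A_i:d-1}^{A_{\pi(i)}:1}\Big)\Big\},$$ where $\delta$ is the graph distance in the $1$-skeleton of $\mathscr{B}$ and $\mathscr{B}^0$ is the set of vertices of $\mathscr{B}$. Moreover, equality holds whenever all the $\alpha_i$ lie in a common apartment.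
   Context: Throughout, $p$ is a fixed prime and $d\ge 2$ a fixed integer. $\nu:\mathbb{Q}_p\to\mathbb{Z}\cup\{\infty\}$ is the $p$-adic valuation with $\nu(p)=1$, $\nu(0)=\infty$. For a square matrix $X$ over $\mathbb{Q}_p$, $|X|_p:=\nu(\det X)$. $S_n$ is the symmetric group on $\{1,\dots,n\}$. Building. A $\mathbb{Z}_p$-lattice in $\mathbb{Q}_p^d$ is a finitely generated $\mathbb{Z}_p$-submodule spanning $\mathbb{Q}_p^d$ over $\mathbb{Q}_p$. Lattices $\mathcal{L},\mathcal{L}'$ are homothetic if $\mathcal{L}'=a\mathcal{L}$ for some $a\in\mathbb{Q}_p^\times$. The building $\mathscr{B}=\mathscr{B}(\mathrm{SL}_d(\mathbb{Q}_p))$ is the abstract simplicial complex whose vertices are the homothety classes of $\mathbb{Z}_p$-lattices in $\mathbb{Q}_p^d$, and whose $k$-simplices are the sets $\{[\mathcal{L}_0],\dots,[\mathcal{L}_k]\}$ for chains of lattices $\mathcal{L}_0\supsetneq\mathcal{L}_1\supsetneq\cdots\supsetneq\mathcal{L}_k\supsetneq p\mathcal{L}_0$. For each basis $\{w_1,\dots,w_d\}$ of $\mathbb{Q}_p^d$, the corresponding apartment is the subcomplex of $\mathscr{B}$ generated by the vertices given by the lattices $\mathbb{Z}_p[p^{e_1}w_1,\dots,p^{e_d}w_d]$ (the $\mathbb{Z}_p$-span), $e_1,\dots,e_d\in\mathbb{Z}$. Matrix representatives. Given a basis $\mathcal{F}=\{u_1,\dots,u_d\}$ of $\mathbb{Q}_p^d$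 and $A\in\mathrm{GL}_d(\mathbb{Q}_p)$, $A_v=A_{v:\mathcal{F}}$ denotes the vertex given by the $\mathbb{Z}_p$-lattice spanned by the vectors $v_i=\sum_{j}A_{i,j}u_j$, $i=1,\dots,d$. The numbers $m$. For $A,B\in\mathrm{GL}_d(\mathbb{Q}_p)$ and $0\le i\le d$, $m_{A:i}^{B:d-i}=m_{A:i,B:d-i}$ is the minimum of $|X|_p$ over all $d\times d$ matrices $X$ composed of $i$ rows of $A$ (with distinct row indices) and $d-i$ rows of $B$ (with distinct row indices). *)

(* Defs.v *)
From HB Require Import structures.
From mathcomp Require Import all_boot all_order all_algebra all_fingroup.
From mathcomp Require Import boolp classical_sets constructive_ereal.

Set Implicit Arguments.
Unset Strict Implicit.
Unset Printing Implicit Defensive.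

Import Order.TTheory GRing.Theory Num.Theory.
Local Open Scope classical_set_scope.
Local Open Scope ring_scope.

(* Z_p as the inverse limit of the rings Z/p^n, where Z/p^n is represented by
   the integers in [0, p^n): [coherent] forces [zp_seq x n] to be such a
   representative.  The primality proof is a parameter of the type, so that
   the integral domain structure can be attached to it. *)
Record padic_int (p : nat) (p_pr : prime p) := PadicInt {
  zp_seq :> nat -> int;
  coherent : forall n, zp_seq n = (zp_seq n.+1 %% (p ^ n)%:Z)%Z
}.

Section PadicIntRing.
Variables (p : nat) (p_pr : prime p).
Local Notation Zp := (padic_int p_pr).
Local Notation q n := ((p ^ n)%:Z).
Implicit Types x y z : Zp.

HB.instance Definition _ := gen_eqMixin Zp.
HB.instance Definition _ := gen_choiceMixin Zp.

Lemma padic_int_eq x y : (forall n, x n = y n) -> x = y.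
Proof.
case: x y => [f fP] [g gP] /= /funext fg; subst g.
by congr PadicInt; apply: Prop_irrelevance.
Qed.

Lemma q_gt0 n : 0 < q n.
Proof. by rewrite ltz_nat expn_gt0 prime_gt0. Qed.

Lemma q_neq0 n : q n != 0.
Proof. by rewrite gt_eqF ?q_gt0. Qed.

Lemma dvdz_q m n : (m <= n)%N -> (q m %| q n)%Z.
Proof. by move=> mn; rewrite dvdzE /= dvdn_exp2l. Qed.

Lemma modz_q m n a : (m <= n)%N -> ((a %% q n)%Z = a %[mod q m])%Z.
Proof.
move=> /dvdz_q/dvdzP[c qE]; rewrite {2}(divz_eq a (q n)) qE mulrA.
by rewrite modzMDl.
Qed.

Lemma zp_modK x n : (x n %% q n)%Z = x n.
Proof. by rewrite (coherent x n) modz_mod. Qed.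

Lemma zp_mod x m n : (m <= n)%N -> (x n %% q m)%Z = x m.
Proof.
elim: n => [|n IHn]; first by rewrite leqn0 => /eqP->; exact: zp_modK.
rewrite leq_eqVlt ltnS => /predU1P[->|mn]; first exact: zp_modK.
by rewrite -(IHn mn) (coherent x n) modz_q.
Qed.

Definition coherent_seq (f : nat -> int) :=
  forall n, (f n.+1 = f n %[mod q n])%Z.

Lemma padic_subproof f : coherent_seq f ->
  forall n, (f n %% q n)%Z = ((f n.+1 %% q n.+1)%Z %% q n)%Z.
Proof. by move=> fP n; rewrite modz_q // fP. Qed.

Definition mk_padic f (fP : coherent_seq f) : Zp :=
  PadicInt p_pr (padic_subproof fP).

Lemma zp_coherent x : coherent_seq x.
Proof. by move=> n; rewrite (zp_mod x (leqnSn n)) zp_modK. Qed.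

Lemma const_coherent a : coherent_seq (fun=> a).
Proof. by []. Qed.
Lemma add_coherent x y : coherent_seq (fun n => x n + y n).
Proof. by move=> n; rewrite -modzDm !zp_coherent modzDm. Qed.
Lemma opp_coherent x : coherent_seq (fun n => - x n).
Proof. by move=> n; rewrite -modzNm zp_coherent modzNm. Qed.
Lemma mul_coherent x y : coherent_seq (fun n => x n * y n).
Proof. by move=> n; rewrite -modzMm !zp_coherent modzMm. Qed.

Definition zp_const a := mk_padic (const_coherent a).
Definition zp_add x y := mk_padic (add_coherent x y).
Definition zp_opp x := mk_padic (opp_coherent x).
Definition zp_mul x y := mk_padic (mul_coherent x y).

Fact zp_addA : associative zp_add.
Proof.
by move=> x y z; apply: padic_int_eq => n /=; rewrite modzDmr modzDml addrA.
Qed.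
Fact zp_addC : commutative zp_add.
Proof. by move=> x y; apply: padic_int_eq => n /=; rewrite addrC. Qed.
Fact zp_add0 : left_id (zp_const 0) zp_add.
Proof.
by move=> x; apply: padic_int_eq => n /=; rewrite mod0z add0r zp_modK.
Qed.
Fact zp_addN : left_inverse (zp_const 0) zp_opp zp_add.
Proof.
by move=> x; apply: padic_int_eq => n /=; rewrite modzDml addNr.
Qed.

HB.instance Definition _ :=
  GRing.isZmodule.Build Zp zp_addA zp_addC zp_add0 zp_addN.

Fact zp_mulA : associative zp_mul.
Proof.
by move=> x y z; apply: padic_int_eq => n /=; rewrite modzMmr modzMml mulrA.
Qed.
Fact zp_mulC : commutative zp_mul.
Proof. by move=> x y; apply: padic_int_eq => n /=; rewrite mulrC. Qed.
Fact zp_mul1 : left_id (zp_const 1) zp_mul.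
Proof.
by move=> x; apply: padic_int_eq => n /=; rewrite modzMml mul1r zp_modK.
Qed.
Fact zp_mulDl : left_distributive zp_mul zp_add.
Proof.
move=> x y z; apply: padic_int_eq => n /=.
by rewrite modzMml modzDm mulrDl.
Qed.
Fact zp_1neq0 : zp_const 1 != 0.
Proof.
apply/eqP => /(congr1 (fun x : Zp => x 1%N)) /=.
by rewrite mod0z expn1 modz_small // ltz_nat prime_gt1.
Qed.

HB.instance Definition _ := GRing.Zmodule_isComNzRing.Build Zp
  zp_mulA zp_mulC zp_mul1 zp_mulDl zp_1neq0.

Lemma zp0E n : (0 : Zp) n = 0.
Proof. by rewrite /= mod0z. Qed.
Lemma zp1E n : (1 : Zp) n = (1 %% q n)%Z.
Proof. by []. Qed.
Lemma zpDE x y n : (x + y) n = ((x n + y n) %% q n)%Z.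
Proof. by []. Qed.
Lemma zpNE x n : (- x) n = (- x n %% q n)%Z.
Proof. by []. Qed.
Lemma zpME x y n : (x * y) n = ((x n * y n) %% q n)%Z.
Proof. by []. Qed.

Lemma zp_neq0P x : reflect (exists n, x n != 0) (x != 0).
Proof.
apply: (iffP idP) => [/eqP x0|[n xn]]; last first.
  by apply: contraNneq xn => ->; rewrite zp0E.
apply: contrapT => /forallNP xn; apply: x0; apply: padic_int_eq => n.
by rewrite zp0E; apply/eqP; move: (xn n) => /negP; rewrite negbK.
Qed.

Definition zp_unit : {pred Zp} := fun x => `[< exists y, y * x = 1 >].

Definition zp_inv x := if pselect (exists y, y * x = 1) is left h
  then projT1 (cid h) else x.

Fact zp_mulVx : {in zp_unit, left_inverse 1 zp_inv *%R}.
Proof.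
move=> x /asboolP ux; rewrite /zp_inv; case: pselect => // h.
exact: (projT2 (cid h)).
Qed.
Fact zp_unitPl x y : y * x = 1 -> zp_unit x.
Proof. by move=> yx; apply/asboolP; exists y. Qed.
Fact zp_inv_out : {in [predC zp_unit], zp_inv =1 id}.
Proof. by move=> x /asboolPn ux; rewrite /zp_inv; case: pselect. Qed.

HB.instance Definition _ := GRing.ComNzRing_hasMulInverse.Build Zp
  zp_mulVx zp_unitPl zp_inv_out.

Fact zp_integral : GRing.integral_domain_axiom Zp.
Proof.
move=> x y xy0; apply/norP => -[/zp_neq0P[m xm] /zp_neq0P[n yn]].
have xN : x (m + n)%N != 0.
  by apply: contraNneq xm => x0; rewrite -(zp_mod x (leq_addr n m)) x0 mod0z.
have yN : y (m + n)%N != 0.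
  by apply: contraNneq yn => y0; rewrite -(zp_mod y (leq_addl m n)) y0 mod0z.
have := congr1 (fun z : Zp => z (m + n)%N) xy0; rewrite /= mod0z.
move=> /dvdz_mod0P; rewrite dvdzE abszM /=.
rewrite pfactor_dvdn // ?muln_gt0 ?absz_gt0 ?xN // lognM ?absz_gt0 //.
suff lt_log (z : Zp) k : (k <= m + n)%N -> z k != 0 -> z (m + n)%N != 0 ->
    (logn p `|z (m + n)| < k)%N.
  have lx := lt_log x m (leq_addr _ _) xm xN.
  have ly := lt_log y n (leq_addl _ _) yn yN.
  by rewrite leqNgt -addnS leq_add // ltnW.
move=> kN zk zN; rewrite ltnNge -pfactor_dvdn ?absz_gt0 //.
apply: contra zk => dv; apply/eqP; rewrite -(zp_mod z kN).
by apply/dvdz_mod0P; rewrite dvdzE.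
Qed.

HB.instance Definition _ := GRing.ComUnitRing_isIntegral.Build Zp zp_integral.

Lemma zp_natE k n : (k%:R : Zp) n = (k%:Z %% q n)%Z.
Proof.
elim: k => [|k IHk]; first by rewrite zp0E mod0z.
by rewrite -natr1 zpDE IHk zp1E modzDm -PoszD addn1.
Qed.

Lemma zp_unitP x : x 1%N != 0 -> x \is a GRing.unit.
Proof.
move=> x1; have cop n : coprimez (x n) (q n).
  case: n => [|n]; first by rewrite /coprimez gcdzC gcd1z.
  rewrite coprimez_sym coprimezE /= coprimeXl // prime_coprime //.
  apply: contra x1 => px; apply/eqP; rewrite -(zp_mod x (ltn0Sn n)).
  by apply/dvdz_mod0P; rewrite dvdzE /= expn1.
pose y n := (egcdz (x n) (q n)).1.
have yP n : (y n * x n = 1 %[mod q n])%Z.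
  rewrite /y; case: egcdzP => u v /= uv _.
  by move/eqP: (cop n); rewrite -uv => <-; rewrite addrC modzMDl.
have yc : coherent_seq y.
  move=> n; apply/eqP; rewrite eqz_mod_dvd.
  rewrite -(@Gauss_dvdzl _ _ (x n)); last by rewrite coprimez_sym.
  rewrite mulrBl -eqz_mod_dvd yP -modzMmr -(zp_coherent x) modzMmr.
  by rewrite -(modz_q _ (leqnSn n)) yP modz_q.
apply/unitrPr; exists (mk_padic yc); apply: padic_int_eq => n.
by rewrite zpME zp1E /= modzMmr mulrC yP.
Qed.

Lemma zp_divP x n : x n = 0 -> exists y, x = p%:R ^+ n * y.
Proof.
move=> xn; have dv m : (q n %| x (n + m)%N)%Z.
  by apply/dvdz_mod0P; rewrite (zp_mod x (leq_addr m n)).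
pose y m := (x (n + m)%N %/ q n)%Z.
have yE m : x (n + m)%N = q n * y m by rewrite mulrC /y divzK.
have yc : coherent_seq y.
  move=> m; apply/eqP; rewrite eqz_mod_dvd.
  rewrite -(dvdz_mul2l (q_neq0 n)) mulrBr -!yE -PoszM -expnD.
  by rewrite -eqz_mod_dvd addnS zp_coherent.
exists (mk_padic yc); apply: padic_int_eq => m.
rewrite -natrX zpME zp_natE /= modzMm -yE.
by rewrite (zp_mod x (leq_addl n m)).
Qed.

Lemma zp_decomp x : x != 0 ->
  exists n, exists2 u, u \is a GRing.unit & x = p%:R ^+ n * u.
Proof.
move=> /zp_neq0P x0; have xm := ex_minnP x0; case: xm => -[|n] xn xmin.
  by move: xn; rewrite -(zp_modK x 0) modz1 eqxx.
have /eqP/zp_divP[u xE] : x n == 0.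
  by apply: contraTT isT => /xmin; rewrite ltnn.
exists n, u => //; apply: zp_unitP; apply: contraNneq xn => u1.
have [v vE] := zp_divP u1.
by rewrite xE vE expr1 mulrA -exprSr -natrX zpME zp_natE modzz mul0r mod0z.
Qed.

Lemma zp_pNunit : (p%:R : Zp) \isn't a GRing.unit.
Proof.
apply/negP => /unitrPr[y /(congr1 (fun z : Zp => z 1%N))] /eqP.
rewrite zpME zp_natE zp1E expn1 modzz mul0r mod0z.
by rewrite modz_small // ltz_nat prime_gt1.
Qed.

Lemma zp_p_neq0 : (p%:R : Zp) != 0.
Proof.
apply/zp_neq0P; exists 2%N; rewrite zp_natE modz_small ?lt0r_neq0 //.
  by rewrite ltz_nat prime_gt0.
by rewrite lez_nat ltz_nat /= -{1}(expn1 p) ltn_exp2l // prime_gt1.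
Qed.

End PadicIntRing.

Notation padic p_pr := {fraction (padic_int p_pr)}.

Section Valuation.
Variables (p : nat) (p_pr : prime p).
Local Notation Zp := (padic_int p_pr).
Local Notation Qp := (padic p_pr).
Local Notation "a %:F" := (@tofrac Zp a).

(* The k such that x = p^k u with u a unit of Z_p, for x != 0: it exists and
   is unique by [padic_decomp] and [padic_valE] below. *)
Definition padic_val (x : Qp) : \bar int :=
  if x == 0 then +oo%E
  else (xget 0 [set k : int | exists2 u : Zp, u \is a GRing.unit
                                & x = p%:R ^ k * u%:F])%:E.

Lemma padic_p_neq0 : (p%:R : Qp) != 0.
Proof. by rewrite -(rmorph_nat (@tofrac Zp)) tofrac_eq0 zp_p_neq0. Qed.

Lemma padic_fracP (x : Qp) : exists a b : Zp, b != 0 /\ x * b%:F = a%:F.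
Proof.
elim/quotW: x => r; exists (\n_r), (\d_r); split; first exact: denom_ratioP.
unlock tofrac; rewrite -[LHS]FracField.pi_mul; apply/eqmodP.
rewrite /= FracField.equivfE /FracField.mulf.
by rewrite !numden_Ratio ?mulf_neq0 ?oner_neq0 ?denom_ratioP // !mulr1 mulrC.
Qed.

Lemma padic_decomp (x : Qp) : x != 0 ->
  exists k : int, exists2 u : Zp, u \is a GRing.unit & x = p%:R ^ k * u%:F.
Proof.
have [a [b [b0 xb]]] := padic_fracP x => x0.
have bF0 : b%:F != 0 by rewrite tofrac_eq0.
have a0 : a != 0 by rewrite -tofrac_eq0 -xb mulf_neq0.
have [n [u uU aE]] := zp_decomp a0; have [m [v vU bE]] := zp_decomp b0.
exists (n%:Z - m%:Z), (u / v); first by rewrite rpredM ?rpredV.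
apply: (mulIf bF0); rewrite xb aE bE !rmorphM !rmorphXn /= !rmorph_nat.
rewrite expfzDr ?padic_p_neq0 // -exprnP -exprnN.
have vF : (v^-1)%:F * v%:F = 1 by rewrite -rmorphM mulVr ?rmorph1.
rewrite [RHS]mulrACA mulfVK ?expf_neq0 ?padic_p_neq0 //.
by rewrite -mulrA vF mulr1.
Qed.

Lemma padic_valE (k : int) (u : Zp) : u \is a GRing.unit ->
  padic_val (p%:R ^ k * u%:F) = k%:E.
Proof.
move=> uU; have uF0 (v : Zp) : v \is a GRing.unit -> v%:F != 0.
  by move=> vU; rewrite tofrac_eq0; apply: contraTneq vU => ->; rewrite unitr0.
rewrite /padic_val mulf_eq0 expfz_eq0 (negPf padic_p_neq0) andbF.
rewrite (negPf (uF0 _ uU)) /=; congr EFin.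
apply: xget_unique => [|l [v vU]]; first by exists u.
have le_kl (i j : int) (w z : Zp) : w \is a GRing.unit ->
    p%:R ^ i * w%:F = p%:R ^ j * z%:F -> j <= i.
  move=> wU wz; rewrite leNgt; apply/negP => lij.
  have [n jE] : exists n : nat, j = i + n.+1%:Z.
    exists `|j - i|.-1; rewrite prednK ?absz_gt0 ?subr_eq0 ?gt_eqF //.
    by rewrite gez0_abs ?subr_ge0 ?ltW // [RHS]addrCA subrr addr0.
  move: wz; rewrite jE expfzDr ?padic_p_neq0 // -mulrA => /mulfI.
  move=> /(_ (expfz_neq0 _ padic_p_neq0)) /eqP.
  rewrite -exprnP -(rmorph_nat (@tofrac Zp)) -rmorphXn -rmorphM tofrac_eq.
  move=> /eqP wE; have := wU; rewrite wE exprS -mulrA unitrM.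
  by rewrite (negPf (zp_pNunit p_pr)).
move=> uv; apply/eqP.
by rewrite eq_le (le_kl _ _ _ _ uU uv) (le_kl _ _ _ _ vU (esym uv)).
Qed.

End Valuation.

Section Building.
Variables (p : nat) (p_pr : prime p) (d : nat).
Local Notation Zp := (padic_int p_pr).
Local Notation Qp := (padic p_pr).
Local Notation V := 'rV[Qp]_d.
Implicit Types (L : set V) (s w : d.-tuple V).

Definition zp_span k (s : k.-tuple V) : set V :=
  [set \sum_(i < k) tofrac (c i) *: tnth s i | c in [set: 'I_k -> Zp]].

(* A finite set of Z_p-generators of L spans Q_p^d over Q_p iff L does. *)
Definition is_lattice L : Prop :=
  exists k (s : k.-tuple V), L = zp_span s /\ <<s>>%VS = fullv.

Definition lattice_scale (a : Qp) L : set V := [set a *: v | v in L].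

Definition homothetic L L' : Prop :=
  exists2 a : Qp, a != 0 & L' = lattice_scale a L.

Definition homothety_class L : set (set V) :=
  [set L' | is_lattice L' /\ homothetic L L'].

Record vertex := Vertex {
  vertex_class :> set (set V);
  vertexP : exists2 L, is_lattice L & vertex_class = homothety_class L
}.

Definition vertex_of (L : set V) (x : vertex) : Prop :=
  is_lattice L /\ vertex_class x = homothety_class L.

Definition lattice_chain k (L : 'I_k.+1 -> set V) : Prop :=
  [/\ forall i, is_lattice (L i),
      forall i j : 'I_k.+1, (i < j)%N -> L j `<` L i
    & lattice_scale p%:R (L ord0) `<` L ord_max].

Definition simplex k (S : set vertex) : Prop :=
  exists2 L : 'I_k.+1 -> set V, lattice_chain L
    & S = [set x | exists i, vertex_of (L i) x].

(* The edges of the 1-skeleton.  The two lattices of a chain are never homothetic,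
   so adjacent vertices are distinct. *)
Definition adjacent (x y : vertex) : Prop := simplex 1 [set x; y].

Definition walk (x y : vertex) (k : nat) : Prop :=
  exists c : nat -> vertex,
    [/\ c 0%N = x, c k = y & forall i, (i < k)%N -> adjacent (c i) (c i.+1)].

(* Length of a shortest walk, +oo if there is none. *)
Definition graph_dist (x y : vertex) : \bar int :=
  if pselect (exists k, `[< walk x y k >]) is left h then (ex_minn h)%:Z%:E
  else +oo%E.

(* The vertex set of the apartment; the apartment itself is the full
   subcomplex on it. *)
Definition apartment w : set vertex :=
  [set x | exists e : 'I_d -> int,
     vertex_of (zp_span [tuple p%:R ^ e i *: tnth w i | i < d]) x].

(* The basis vectors and the lattice generators are rows: A acts on the tuple
   of basis vectors from the left. *)
Definition matrix_vertex (F : d.-tuple V) (A : 'M[Qp]_d) (x : vertex) : Prop :=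
  vertex_of (zp_span [tuple \sum_(j < d) A i j *: tnth F j | i < d]) x.

(* The minimum of nu (det X) over the X made of i rows of A and d - i rows of
   B.  The rows of [col_mx A B] with index below d are those of A, so [f]
   selects i rows of A and d - i rows of B, without repetition.  The neutral
   element +oo is only reached when there is no such f or all these X are
   singular. *)
Definition min_val_det (A B : 'M[Qp]_d) (i : nat) : \bar int :=
  \big[Order.min/+oo%E]_(f : {ffun 'I_d -> 'I_(d + d)}
      | injectiveb f && (#|[set k | (f k < d)%N]%SET| == i))
    padic_val (\det (rowsub f (col_mx A B))).

End Building.

Definition is_minimum (S : set (\bar int)) (m : \bar int) : Prop :=
  S m /\ lbound S m.

(* Main.v *)
Require Import Defs.
From HB Require Import structures.
From mathcomp Require Import all_boot all_order all_algebra all_fingroup.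
From mathcomp Require Import boolp classical_sets constructive_ereal.
From mathcomp Require Import zify.

Set Implicit Arguments.
Unset Strict Implicit.
Unset Printing Implicit Defensive.

Import Order.TTheory GRing.Theory Num.Theory.
Local Open Scope classical_set_scope.
Local Open Scope ring_scope.

(** For lattices L and K, let D(L, K) be the least integer a such that
    p^a K is contained in L.

    Distance.  delta([L], [K]) = D(L, K) + D(K, L).  The relation
    [lattices_within] (p^b K <= L and p^c L <= K with b + c <= a) is additive
    along walks and holds with a = 1 for neighbours, so the sum is at most the
    length of any walk.  Conversely, after rescaling, p^k L <= K <= L, and the
    lattices K + p^i L, 0 <= i <= k, form a walk from [L] to [K] up to
    repetitions ([graph_dist_within]).

    Determinants.  If the rows of A and C A, in the coordinates of F, generate
    L and K, then p^a K <= L iff p^a C has entries in Z_p, so D(L, K) is minus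
    the least valuation of an entry of C.  A matrix made of rows of A and C A
    is N A, with N made of rows of 1 and C.  If N has exactly one row from C,
    its determinant is at least as divisible by p as some entry of C, and every
    entry of C is the determinant of such an N.  Hence
    m_{A:d} - m_{A:d-1, CA:1} = D(L, K) ([min_val_det_diff]).

    The inequality.  For a lattice K of beta and a permutation pi,
    sum_i delta(alpha_i, beta) = sum_i (D(L_i, K) + D(K, L_pi(i))), which is
    at least sum_i D(L_i, L_pi(i)) by the triangle inequality for D
    ([sum_dist_ge]).

    Equality in an apartment.  If L_i is spanned by the p^(e_ik) w_k, then
    D(L_i, L_j) = max_k (e_ik - e_jk).  The integral duality theorem of the
    assignment problem ([assignment_duality]) provides integers u_i, v_j with
    u_i + v_j >= D(L_i, L_j) and a permutation pi such that
    sum_i (u_i + v_i) = sum_i D(L_i, L_pi(i)).  The lattice K spanned by the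
    p^(f_k) w_k with f_k = max_i (e_ik - u_i) satisfies D(L_i, K) <= u_i and
    D(K, L_i) <= v_i, so its class has sum of distances at most
    sum_i D(L_i, L_pi(i)) ([apartment_sum_dist_le]). *)

(** * Integrality and the p-adic valuation *)

Section PadicIntegers.
Variables (p : nat) (p_pr : prime p).
Local Notation Zp := (padic_int p_pr).
Local Notation Qp := (padic p_pr).
Implicit Types x y : Qp.

(** The elements of Z_p inside Q_p. *)
Definition integral x : Prop := exists c : Zp, x = tofrac c.

Lemma integral0 : integral 0.
Proof. by exists 0; rewrite rmorph0. Qed.

Lemma integral1 : integral 1.
Proof. by exists 1; rewrite rmorph1. Qed.

Lemma padic_val0 : padic_val (0 : Qp) = +oo%E.
Proof. by rewrite /padic_val eqxx. Qed.

Lemma padic_val_fin x : x != 0 -> exists k, padic_val x = k%:E.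
Proof.
move=> x0; have [k [u uU ->]] := padic_decomp x0.
by exists k; rewrite padic_valE.
Qed.

Lemma integral_val x : integral x <-> (0 <= padic_val x)%E.
Proof.
have [->|x0] := eqVneq x 0.
  by rewrite padic_val0 leey; split=> // _; exact: integral0.
have [k [u uU xE]] := padic_decomp x0.
rewrite xE padic_valE // lee_fin; split=> [[c]|k0].
  have [->|c0] := eqVneq c 0.
    move=> ck; move: x0; rewrite xE ck rmorph0 eqxx //.
  have [n [v vU cE]] := zp_decomp c0.
  rewrite cE rmorphM rmorphXn rmorph_nat exprnP.
  move=> /(congr1 (@padic_val _ p_pr)); by rewrite !padic_valE // => -[->].
exists (p%:R ^+ `|k|%N * u); rewrite rmorphM rmorphXn rmorph_nat.
by rewrite exprnP gez0_abs.
Qed.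

Lemma padic_valM x y : padic_val (x * y) = (padic_val x + padic_val y)%E.
Proof.
have vN (z : Qp) : padic_val z != -oo%E.
  by rewrite /padic_val; case: ifP.
have [->|x0] := eqVneq x 0; first by rewrite mul0r padic_val0 addye.
have [->|y0] := eqVneq y 0; first by rewrite mulr0 padic_val0 addey.
have [k [u uU xE]] := padic_decomp x0.
have [l [v vU yE]] := padic_decomp y0.
have -> : x * y = p%:R ^ (k + l) * tofrac (u * v).
  by rewrite xE yE rmorphM expfzDr ?padic_p_neq0 // mulrACA.
by rewrite xE yE !padic_valE // unitrM uU.
Qed.

Lemma padic_val_expp (a : int) : padic_val (p%:R ^ a : Qp) = a%:E.
Proof.
by rewrite -[_ ^ a]mulr1 -(rmorph1 (@tofrac Zp)) padic_valE ?unitr1.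
Qed.

Lemma integral_expp_mul (a : int) x :
  integral (p%:R ^ a * x) <-> ((- a)%:E <= padic_val x)%E.
Proof.
rewrite integral_val padic_valM padic_val_expp.
case: (padic_val x) => [r| |]; rewrite ?leey //=.
by rewrite -EFinD !lee_fin -lerBlDl sub0r.
Qed.

Lemma integral_expp (a : int) : integral (p%:R ^ a : Qp) <-> 0 <= a.
Proof. by rewrite integral_val padic_val_expp lee_fin. Qed.

Lemma integral_det n (M : 'M[Qp]_n) :
  (forall i j, integral (M i j)) -> integral (\det M).
Proof.
move=> hM; pose N := \matrix_(i, j) projT1 (cid (hM i j)).
exists (\det N); rewrite -det_map_mx; congr (\det _).
by apply/matrixP=> i j; rewrite !mxE; case: cid.
Qed.

End PadicIntegers.

(** * Integral duality for the assignment problem *)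

Section Assignment.
Variables (n : nat) (c : 'I_n -> 'I_n -> int).
Implicit Types (u v : 'I_n -> int) (s : 'S_n).

(** The constraints of the linear program dual to that of maximizing the sum
    of the c i (s i) over the permutations s. *)
Definition dual_feasible u v := forall i j, c i j <= u i + v j.

Lemma dual_feasible_sum_ge u v s :
  dual_feasible u v -> \sum_i c i (s i) <= \sum_i (u i + v i).
Proof.
move=> uv; rewrite big_split /= (reindex_inj (@perm_inj _ s) (F := v)) /=.
by rewrite -big_split; apply: ler_sum => i _; apply: uv.
Qed.

Lemma dual_feasible_minimal : exists u v, dual_feasible u v /\
  forall u' v', dual_feasible u' v' ->
    \sum_i (u i + v i) <= \sum_i (u' i + v' i).
Proof.
pose P (k : nat) := exists u v, dual_feasible u v /\
  \sum_i (u i + v i) = \sum_i c i i + k%:Z.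
have Pv u v : dual_feasible u v ->
    \sum_i (u i + v i)
      = \sum_i c i i + `|(\sum_i (u i + v i) - \sum_i c i i)%R|%N%:Z.
  move=> /(dual_feasible_sum_ge 1); under eq_bigr do rewrite perm1.
  by move=> h; rewrite gez0_abs ?subr_ge0 // addrC subrK.
have [k0 Pk0] : exists k, `[< P k >].
  have uv : dual_feasible (fun i => \sum_j `|c i j|) (fun=> 0).
    move=> i j; rewrite addr0 (bigD1 j) //= (le_trans (ler_norm _)) // lerDl.
    exact: sumr_ge0.
  by eexists; apply/asboolP; do 2 eexists; split; [exact: uv|exact: Pv].
have exP : exists k, `[< P k >] by exists k0.
case: (ex_minnP exP) => k /asboolP[u [v [uv uvE]]] kmin.
exists u, v; split=> // u' v' uv'; rewrite uvE (Pv _ _ uv') lerD2l lez_nat.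
by apply: kmin; apply/asboolP; exists u', v'; split=> //; apply: Pv.
Qed.

(** The optimal value of the dual program is attained at an integral point and
    equals the maximal weight of a permutation. *)
Theorem assignment_duality : exists u v (s : 'S_n),
  dual_feasible u v /\ \sum_i (u i + v i) = \sum_i c i (s i).
Proof.
have [u [v [uv uvmin]]] := dual_feasible_minimal.
pose tight i j := c i j == u i + v j.
pose ntight (s : 'S_n) := #|[set i | tight i (s i)]%SET|.
(* s has as many tight pairs (i, s i) as possible; if (i, s i) is loose, then
   either s or (u, v) can be improved, according to whether i lies on a cycle of
   the graph e below. *)
pose s := [arg max_(s > (1%g : 'S_n)) ntight s].
have smax t : (ntight t <= ntight s)%N.
  by rewrite /s; case: arg_maxnP => // s' _; apply.
exists u, v, s; split=> //.
suff all_tight i : tight i (s i).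
  rewrite big_split /= (reindex_inj (@perm_inj _ s) (F := v)) /= -big_split.
  by apply: eq_bigr => i _; rewrite (eqP (all_tight i)).
apply: contraT => i_loose.
pose e : rel 'I_n := fun i' j' => tight i' (s j').
have [[k /andP[ik ki]]|noback] := pselect (exists k, connect e i k && e k i).
  (* Composing s with the cyclic permutation of a simple e-cycle through i makes
     all pairs along the cycle tight and leaves the others unchanged. *)
  case/connectP: ik ki => q0 q0P ->; case/shortenP: q0P => q eq uq _ ei.
  pose z := i :: q.
  have ez : path.cycle e z by rewrite /= rcons_path eq.
  have nextI : injective (next z) by apply: can_inj (prev_next uq).
  pose t := (perm nextI * s)%g.
  have := smax t; rewrite leqNgt => /negP[].
  apply: proper_card; apply/properP; split.
    apply/fintype.subsetP => j; rewrite !inE permM permE => tj.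
    have [jz|jz] := boolP (j \in z); first exact: (next_cycle ez).
    by rewrite next_nth (negPf jz).
  exists i; rewrite inE // permM permE.
  by apply: (next_cycle ez); rewrite mem_head.
(* Otherwise the tight neighbours of the set S reachable from i are among the
   s j with j in S and j != i: lowering u on S and raising v at these points
   preserves feasibility and decreases the dual value by 1. *)
pose S := [pred j | connect e i j].
pose u' j := u j - (S j)%:Z.
pose v' j := v j + ((s^-1%g j != i) && S (s^-1%g j))%:Z.
have uv' : dual_feasible u' v'.
  move=> j l; rewrite /u' /v' /S /=; have := uv j l.
  have [Sj|_] /= := boolP (connect e i j); last first.
    by move=> h; apply: (le_trans h); lia.
  have [jl|njl] := boolP (e j (s^-1%g l)).
    rewrite (connect_trans Sj (connect1 jl)).
    have -> : s^-1%g l != i.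
      by apply/eqP => li; apply: noback; exists j; rewrite Sj -li.
    by rewrite addrACA addNr addr0.
  rewrite le_eqVlt; move: njl; rewrite /e /tight permKV => /negPf->/=.
  by case: (_ && _) => /= h; lia.
have := uvmin _ _ uv'; rewrite leNgt => /negP[].
rewrite -subr_gt0 -sumrB.
have -> : \sum_j (u j + v j - (u' j + v' j))
    = \sum_j ((S j)%:Z - ((j != i) && S j)%:Z).
  rewrite sumrB [X in X - _]big_split [X in _ - X]big_split /=.
  rewrite (reindex_inj (@perm_inj _ s) (F := v)).
  rewrite (reindex_inj (@perm_inj _ s) (F := v')) /= -!big_split -sumrB.
  apply: eq_bigr => j _; rewrite /u' /v' permK.
  by rewrite /S /=; case: (connect e i j); case: (j != i) => /=; lia.
rewrite (bigD1 i) //= eqxx /= connect0 subr0 big1 ?addr0 // => j ->.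
by rewrite subrr.
Qed.

End Assignment.

(** * Lattices and the graph distance *)

Lemma field_factor (k : fieldType) (a c : k) : a != 0 -> c != 0 ->
  exists e, e != 0 /\ c = e * a.
Proof.
by move=> a0 c0; exists (c / a); rewrite mulf_neq0 ?invr_neq0 // divfK.
Qed.

Section Lattices.
Variables (p : nat) (p_pr : prime p) (d : nat).
Local Notation Zp := (padic_int p_pr).
Local Notation Qp := (padic p_pr).
Local Notation V := 'rV[Qp]_d.
Local Notation "c %:F" := (@tofrac Zp c).
Implicit Types (L K : set V) (x y z : vertex p_pr d) (a b : int).

Let pF_neq0 : (p%:R : Qp) != 0 := padic_p_neq0 p_pr.

Lemma expp_neq0 a : (p%:R ^ a : Qp) != 0.
Proof. exact: expfz_neq0. Qed.

Lemma scale_exppD a b (v : V) :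
  p%:R ^ (a + b) *: v = p%:R ^ a *: (p%:R ^ b *: v).
Proof. by rewrite scalerA -(expfzDr _ _ pF_neq0). Qed.

Lemma scale_exppK a (v : V) : p%:R ^ (- a) *: (p%:R ^ a *: v) = v.
Proof. by rewrite -scale_exppD addNr scale1r. Qed.

Lemma scale_exppNK a (v : V) : p%:R ^ a *: (p%:R ^ (- a) *: v) = v.
Proof. by rewrite -scale_exppD subrr scale1r. Qed.

(** Z_p-submodules of Q_p^d, with no condition on generators. *)
Definition zp_submodule L : Prop :=
  [/\ L 0, forall v w, L v -> L w -> L (v + w)
    & forall c v, integral c -> L v -> L (c *: v)].

Lemma submodule_sum L k (f : 'I_k -> V) :
  zp_submodule L -> (forall i, L (f i)) -> L (\sum_(i < k) f i).
Proof. by move=> [L0 LD _] fL; elim/big_ind: _. Qed.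

Lemma zp_span_submodule k (s : k.-tuple V) : zp_submodule (zp_span s).
Proof.
split=> [|_ _ [c _ <-] [e _ <-]|_ _ [c ->] [e _ <-]].
- by exists (fun=> 0) => //; rewrite big1 // => i _; rewrite rmorph0 scale0r.
- exists (fun i => c i + e i) => //; rewrite -big_split.
  by apply: eq_bigr => i _; rewrite rmorphD scalerDl.
- exists (fun i => c * e i) => //; rewrite scaler_sumr.
  by apply: eq_bigr => i _; rewrite rmorphM scalerA.
Qed.

Lemma mem_zp_span k (s : k.-tuple V) i : zp_span s (tnth s i).
Proof.
exists (fun j => (j == i)%:R) => //; rewrite (bigD1 i) //= eqxx rmorph1 scale1r.
by rewrite big1 ?addr0 // => j /negPf->; rewrite rmorph0 scale0r.
Qed.

Lemma zp_span_sub k (s : k.-tuple V) L :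
  zp_submodule L -> (forall i, L (tnth s i)) -> zp_span s `<=` L.
Proof.
move=> Lm sL _ [c _ <-]; apply: submodule_sum => // i.
by case: Lm => _ _; apply=> //; exists (c i).
Qed.

Lemma lattice_submodule L : is_lattice L -> zp_submodule L.
Proof. by move=> [k [s [-> _]]]; apply: zp_span_submodule. Qed.

Lemma submodule_preim L (a : Qp) :
  zp_submodule L -> zp_submodule [set v | L (a *: v)].
Proof.
move=> [L0 LD LZ]; split=> [|v w|c v] /=; first by rewrite scaler0.
  by rewrite scalerDr; apply: LD.
by move=> ci; rewrite scalerA mulrC -scalerA; apply: LZ.
Qed.

Lemma lattice_scale_exppP a L v :
  lattice_scale (p%:R ^ a) L v <-> L (p%:R ^ (- a) *: v).
Proof.
split=> [[w wL <-]|vL]; first by rewrite scale_exppK.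
by exists (p%:R ^ (- a) *: v) => //; rewrite scale_exppNK.
Qed.

Lemma lattice_scale1 L : lattice_scale 1 L = L.
Proof.
by apply/seteqP; split=> [_ [v vL <-]|v vL]; [|exists v]; rewrite ?scale1r.
Qed.

Lemma lattice_scaleA (a b : Qp) L :
  lattice_scale a (lattice_scale b L) = lattice_scale (a * b) L.
Proof.
apply/seteqP; split=> [_ [_ [v vL <-] <-]|_ [v vL <-]].
  by exists v => //; rewrite scalerA.
by exists (b *: v); [exists v|rewrite scalerA].
Qed.

Lemma lattice_scale_span (a : Qp) k (s : k.-tuple V) :
  lattice_scale a (zp_span s) = zp_span [tuple a *: tnth s i | i < k].
Proof.
apply/seteqP; split=> [_ [_ [c _ <-] <-]|_ [c _ <-]].
  exists c => //; rewrite scaler_sumr; apply: eq_bigr => i _.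
  by rewrite tnth_mktuple !scalerA mulrC.
eexists; first by exists c.
rewrite scaler_sumr; apply: eq_bigr => i _.
by rewrite tnth_mktuple !scalerA mulrC.
Qed.

Lemma is_lattice_scale (a : Qp) L :
  a != 0 -> is_lattice L -> is_lattice (lattice_scale a L).
Proof.
move=> a0 [k [s [-> sV]]]; rewrite lattice_scale_span.
do 2 eexists; split; first by [].
apply/eqP; rewrite eqEsubv subvf -sV; apply/span_subvP => v /tnthP[i ->].
rewrite -[tnth s i]scale1r -(mulVf a0) -scalerA; apply/memvZ/memv_span.
by apply/tnthP; exists i; rewrite tnth_mktuple.
Qed.

Lemma lattice_scale_unit (u : Zp) L : u \is a GRing.unit -> zp_submodule L ->
  lattice_scale u%:F L = L.
Proof.
move=> uU [_ _ LZ].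
have uV : u%:F * u^-1%:F = 1 by rewrite -rmorphM mulrV ?rmorph1.
apply/seteqP; split=> [_ [v vL <-]|v vL]; first by apply: LZ => //; exists u.
exists (u^-1%:F *: v); first by apply: LZ => //; exists u^-1.
by rewrite scalerA uV scale1r.
Qed.

(** Homothety classes only see scalings by powers of p. *)
Lemma homothetic_expp L K : zp_submodule L -> homothetic L K ->
  exists a, K = lattice_scale (p%:R ^ a) L.
Proof.
move=> Lm [c c0 ->]; have [a [u uU cE]] := padic_decomp c0; exists a.
by rewrite cE -lattice_scaleA (lattice_scale_unit uU Lm).
Qed.

Lemma homothetic_refl L : homothetic L L.
Proof. by exists 1; rewrite ?oner_neq0 ?lattice_scale1. Qed.

Lemma vertex_of_inj L x y : vertex_of L x -> vertex_of L y -> x = y.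
Proof.
case: x y => [X Xh] [Y Yh] [_ /= XE] [_ /= YE]; move: Xh Yh; rewrite XE YE.
by move=> Xh Yh; congr Vertex; apply: Prop_irrelevance.
Qed.

Lemma vertex_of_exists L : is_lattice L -> exists x, vertex_of L x.
Proof.
move=> Ll.
have h : exists2 L', is_lattice L' & homothety_class L = homothety_class L'.
  by exists L.
by exists (Vertex h).
Qed.

Lemma vertex_has_lattice x : exists L, vertex_of L x.
Proof. by case: (vertexP x) => L Ll xE; exists L. Qed.

Lemma vertex_of_homothetic L K x :
  vertex_of L x -> vertex_of K x -> exists a, K = lattice_scale (p%:R ^ a) L.
Proof.
move=> [Ll xL] [Kl xK]; apply: homothetic_expp.
  exact: lattice_submodule.
have : homothety_class K K by split=> //; exact: homothetic_refl.
by rewrite -xK xL => -[].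
Qed.

Lemma vertex_of_scale L (a : Qp) x :
  a != 0 -> vertex_of L x -> vertex_of (lattice_scale a L) x.
Proof.
move=> a0 [Ll xL]; split; first exact: is_lattice_scale.
rewrite xL; apply/seteqP; split=> K [Kl [c c0 KE]]; split=> //.
  have [e [e0 cE]] := field_factor a0 c0.
  by exists e => //; rewrite KE cE lattice_scaleA.
by exists (c * a); [apply: mulf_neq0 c0 a0|rewrite KE lattice_scaleA].
Qed.

(** p^a K is contained in L, that is, D(L, K) <= a. *)
Definition scaled_sub L K a : Prop := forall v, K v -> L (p%:R ^ a *: v).

Lemma scaled_sub_trans L K M a b :
  scaled_sub L K a -> scaled_sub K M b -> scaled_sub L M (a + b).
Proof. by move=> LK KM v /KM/LK; rewrite scale_exppD. Qed.

Lemma scaled_sub_le L K a b :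
  zp_submodule L -> a <= b -> scaled_sub L K a -> scaled_sub L K b.
Proof.
move=> [_ _ LZ] ab LK v /LK; rewrite -(subrK a b) scale_exppD.
by apply: LZ; apply/integral_expp; rewrite subr_ge0.
Qed.

Lemma scaled_sub_scale_l L K a b :
  scaled_sub (lattice_scale (p%:R ^ b) L) K a <-> scaled_sub L K (a - b).
Proof.
split=> h v /h; first by rewrite lattice_scale_exppP -scale_exppD addrC.
by move=> Lv; rewrite lattice_scale_exppP -scale_exppD addrC.
Qed.

(** A lattice contains all sufficiently high p-power multiples of any vector. *)
Lemma lattice_absorbing L v : is_lattice L ->
  exists k : nat, forall a, k%:Z <= a -> L (p%:R ^ a *: v).
Proof.
move=> [k [s [-> sV]]].
have : v \in <<s>>%VS by rewrite sV memvf.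
move=> /coord_span ->.
have den (c : Qp) : exists k : nat,
    forall a, k%:Z <= a -> integral (p%:R ^ a * c).
  have [->|c0] := eqVneq c 0.
    by exists 0%N => a _; rewrite mulr0; apply: integral0.
  have [l [u uU ->]] := padic_decomp c0; exists `|l|%N => a al.
  by apply/integral_expp_mul; rewrite padic_valE // lee_fin; lia.
pose N i := projT1 (cid (den (coord s i v))).
exists (\max_i N i)%N => a Na.
rewrite scaler_sumr; apply: submodule_sum; first exact: zp_span_submodule.
move=> i; have [_ _ sZ] := zp_span_submodule s.
rewrite scalerA -tnth_nth; apply: sZ (mem_zp_span _ _).
have := projT2 (cid (den (coord s i v))); apply.
apply: le_trans Na; rewrite lez_nat.
exact: (leq_bigmax i).
Qed.

Lemma scaled_sub_exists L K : is_lattice L -> is_lattice K ->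
  exists a, scaled_sub L K a.
Proof.
move=> Ll [k [s [-> _]]].
pose N i := projT1 (cid (lattice_absorbing (tnth s i) Ll)).
exists (\max_i N i)%N%:Z => v.
apply: (zp_span_sub (L := [set v | L (p%:R ^ (\max_i N i)%N%:Z *: v)])) => [|i].
  exact/submodule_preim/lattice_submodule.
apply: (projT2 (cid (lattice_absorbing (tnth s i) Ll))).
by rewrite lez_nat; apply: (leq_bigmax i).
Qed.

(** D(L, K) + D(K, L) <= a, expressed without the minima. *)
Definition lattices_within L K a : Prop :=
  exists b c, [/\ scaled_sub L K b, scaled_sub K L c & b + c <= a].

Lemma within_trans L K M a b : lattices_within L K a ->
  lattices_within K M b -> lattices_within L M (a + b).
Proof.
move=> [a1 [a2 [LK KL aE]]] [b1 [b2 [KM MK bE]]].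
exists (a1 + b1), (b2 + a2); split.
- exact: scaled_sub_trans LK KM.
- exact: scaled_sub_trans MK KL.
- by lia.
Qed.

Lemma within_same_vertex L K x :
  vertex_of L x -> vertex_of K x -> lattices_within L K 0.
Proof.
move=> Lx Kx; have [a ->] := vertex_of_homothetic Lx Kx.
exists (- a), a; rewrite addNr; split=> // v.
  by rewrite lattice_scale_exppP.
by move=> vL; exists v.
Qed.

Lemma within_adjacent L K x y :
  vertex_of L x -> vertex_of K y -> adjacent x y -> lattices_within L K 1.
Proof.
move=> Lx Ky [C [Cl Cdec Cp] xyE].
have Csub (i j : 'I_2) : (i <= j)%N -> C j `<=` C i.
  rewrite leq_eqVlt => /orP[/eqP/val_inj->//|/Cdec[]//].
have Cwithin (i j : 'I_2) : lattices_within (C i) (C j) 1.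
  have CpR k l : scaled_sub (C k) (C l) 1.
    move=> v vl; rewrite expr1z.
    apply: (Csub _ ord_max); first by rewrite -ltnS.
    apply: (properW Cp); exists v => //.
    exact: (Csub ord0 l isT v vl).
  have CR (k l : 'I_2) : (k <= l)%N -> scaled_sub (C k) (C l) 0.
    by move=> kl v /(Csub _ _ kl); rewrite scale1r.
  case: (leqP i j) => [ij|/ltnW ji]; [exists 0, 1|exists 1, 0];
    by split; rewrite ?addr0 //; apply: CR.
have [i xi] : exists i, vertex_of (C i) x.
  have : [set x; y] x by left.
  by rewrite xyE.
have [j yj] : exists j, vertex_of (C j) y.
  have : [set x; y] y by right.
  by rewrite xyE.
have := within_trans (within_same_vertex Lx xi) (Cwithin i j).
by move/within_trans/(_ (within_same_vertex yj Ky)); rewrite add0r addr0.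
Qed.

Lemma within_walk L K x y k :
  vertex_of L x -> vertex_of K y -> walk x y k -> lattices_within L K k.
Proof.
move=> Lx + [c [c0 ck cadj]]; rewrite -ck => {ck y}.
elim: k cadj K => [|k IHk] cadj K Ky.
  by apply: within_same_vertex Lx _; rewrite -c0.
have [M My] := vertex_has_lattice (c k).
have := IHk (fun i ik => cadj i (ltnW ik)) M My.
move/within_trans/(_ (within_adjacent My Ky (cadj k (ltnSn k)))).
by rewrite -PoszD addn1.
Qed.

Lemma walk_cons x y z k : adjacent x y -> walk y z k -> walk x z k.+1.
Proof.
move=> xy [c [c0 ck cadj]]; exists (fun i => if i is j.+1 then c j else x).
by split=> // -[|i] /=; [rewrite c0|rewrite ltnS => /cadj].
Qed.

Lemma adjacent_lattices L K x y : vertex_of L x -> vertex_of K y ->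
  K `<` L -> lattice_scale p%:R L `<` K -> adjacent x y.
Proof.
move=> Lx Ky KL LK.
exists (fun i : 'I_2 => if i == ord0 then L else K).
  split=> [i|i j ij|]; first by case: ifP => _; [case: Lx|case: Ky].
    have -> : i = ord0.
      by apply/val_inj => /=; case: i j ij => [[|[]]//] ? [[|[]]].
    have -> // : j == ord0 = false.
    by apply/negP => /eqP j0; move: ij; rewrite j0.
  by rewrite eqxx.
apply/seteqP; split=> z.
  by case=> ->; [exists ord0|exists ord_max].
move=> [i]; case: ifP => _ zi; [left|right].
  exact: vertex_of_inj zi Lx.
exact: vertex_of_inj zi Ky.
Qed.

(** The lattice M = K + pL, characterized as the least Z_p-submodule containing
    K and pL. *)
Lemma lattice_add_scale L K : is_lattice L -> is_lattice K ->
  exists M, [/\ is_lattice M, K `<=` M, lattice_scale p%:R L `<=` M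
    & forall N, zp_submodule N -> K `<=` N -> lattice_scale p%:R L `<=` N ->
        M `<=` N].
Proof.
move=> [k [s [-> sV]]] [l [t [-> tV]]].
pose s' := [tuple p%:R *: tnth s i | i < k].
exists (zp_span [tuple of t ++ s']).
have Mm := zp_span_submodule [tuple of t ++ s'].
have tl i : tnth [tuple of t ++ s'] (lshift k i) = tnth t i.
  by rewrite tnth_lshift.
have tr i : tnth [tuple of t ++ s'] (rshift l i) = tnth s' i.
  by rewrite tnth_rshift.
rewrite lattice_scale_span; split.
- do 2 eexists; split; first by [].
  apply/eqP; rewrite eqEsubv subvf -tV; apply: sub_span => v vt.
  by rewrite mem_cat vt.
- by apply: zp_span_sub => // i; rewrite -tl; apply: mem_zp_span.
- by apply: zp_span_sub => // i; rewrite -tr; apply: mem_zp_span.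
- move=> N Nm tN sN; apply: zp_span_sub => // i; rewrite -(splitK i).
  case: (split i) => j /=; [rewrite tl|rewrite tr].
    exact/tN/mem_zp_span.
  exact/sN/mem_zp_span.
Qed.

(** By induction on k, using the intermediate lattice M = K + pL.  The vertex of
    M is equal or adjacent to that of L, according to whether M is one of L, pL
    or lies strictly between them. *)
Lemma walk_of_sub k L K x y : vertex_of L x -> vertex_of K y ->
  K `<=` L -> scaled_sub K L k%:Z -> exists2 m, (m <= k)%N & walk x y m.
Proof.
elim: k L x => [|k IHk] L x Lx Ky KL LK.
  exists 0%N => //; suff -> : x = y by exists (fun=> y).
  apply: (vertex_of_inj Lx); have -> // : L = K.
  by apply/seteqP; split=> // v /LK; rewrite scale1r.
have [Ll Kl] := (proj1 Lx, proj1 Ky).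
have [M [Ml KM pLM Mmin]] := lattice_add_scale Ll Kl.
have [Lm Km] := (lattice_submodule Ll, lattice_submodule Kl).
have ML : M `<=` L.
  apply: Mmin => // _ [v vL <-]; case: Lm => _ _; apply=> //.
  by rewrite -[p%:R]expr1z; apply/integral_expp.
have MK : scaled_sub K M k%:Z.
  apply: (Mmin [set v | K (p%:R ^ k%:Z *: v)]); first exact: submodule_preim.
    move=> v vK /=; case: Km => _ _; apply=> //; exact/integral_expp.
  move=> _ [v vL <-] /=; rewrite scalerA -exprnP -exprSr; exact: LK.
have [z Mz] := vertex_of_exists Ml.
have [m mk zy] := IHk _ _ Mz Ky KM MK.
have [LM|LM] := pselect (L `<=` M).
  exists m; first exact: leqW.
  suff -> : x = z by [].
  by apply: (vertex_of_inj Lx); have -> : L = M by apply/seteqP.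
have [MpL|MpL] := pselect (M `<=` lattice_scale p%:R L).
  exists m; first exact: leqW.
  suff -> : x = z by [].
  apply: (vertex_of_inj (vertex_of_scale pF_neq0 Lx)).
  by have -> : lattice_scale p%:R L = M by apply/seteqP.
exists m.+1 => //; apply: walk_cons zy; apply: adjacent_lattices Lx Mz _ _.
  by split.
by split.
Qed.

Lemma walk_of_within L K x y k : vertex_of L x -> vertex_of K y ->
  lattices_within L K k%:Z -> exists2 m, (m <= k)%N & walk x y m.
Proof.
move=> Lx Ky [a [b [LK KL abk]]].
apply: (walk_of_sub Lx (vertex_of_scale (expp_neq0 a) Ky)).
  by move=> v /lattice_scale_exppP/LK; rewrite scale_exppNK.
apply/scaled_sub_scale_l/(scaled_sub_le _ _ KL); last by lia.
exact/lattice_submodule/(proj1 Ky).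
Qed.

(** The graph distance is finite and equal to the least k with
    [lattices_within L K k], whatever the lattices L, K representing the
    vertices. *)
Theorem graph_dist_within L K x y : vertex_of L x -> vertex_of K y ->
  exists m : nat, [/\ graph_dist x y = m%:Z%:E, lattices_within L K m
    & forall k : nat, lattices_within L K k -> (m <= k)%N].
Proof.
move=> Lx Ky.
have [a LK] := scaled_sub_exists (proj1 Lx) (proj1 Ky).
have [b KL] := scaled_sub_exists (proj1 Ky) (proj1 Lx).
have [|m0 _ wm0] := @walk_of_within _ _ _ _ `|a + b| Lx Ky.
  by exists a, b; split=> //; lia.
rewrite /graph_dist; case: pselect => [h|[]]; last first.
  by exists m0; apply/asboolP.
case: ex_minnP => m /asboolP wm mmin; exists m; split=> //.
  exact: within_walk Lx Ky wm.
move=> k /(walk_of_within Lx Ky)[l lk wl]; apply: leq_trans lk.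
by apply: mmin; apply/asboolP.
Qed.

End Lattices.

(** * Determinants made of rows of two matrices *)

Lemma unitmx_det_neq0 (k : fieldType) n (A : 'M[k]_n) :
  A \in unitmx -> \det A != 0.
Proof. by rewrite unitmxE unitfE. Qed.

Section Determinants.
Variables (p : nat) (p_pr : prime p) (d : nat).
Local Notation Zp := (padic_int p_pr).
Local Notation Qp := (padic p_pr).
Local Notation V := 'rV[Qp]_d.
Local Notation "c %:F" := (@tofrac Zp c).

(** The tuple A F: its i-th vector is the combination of F with coefficients in
    the i-th row of A, as in the lattice generators of [matrix_vertex]. *)
Definition row_combination (F : d.-tuple V) (A : 'M[Qp]_d) : d.-tuple V :=
  [tuple \sum_(j < d) A i j *: tnth F j | i < d].

Lemma row_combinationM (F : d.-tuple V) (A C : 'M[Qp]_d) :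
  row_combination (row_combination F A) C = row_combination F (C *m A).
Proof.
apply: eq_from_tnth => i; rewrite !tnth_mktuple.
under eq_bigr do rewrite tnth_mktuple scaler_sumr.
rewrite exchange_big; apply: eq_bigr => k _.
by rewrite mxE scaler_suml; apply: eq_bigr => j _; rewrite scalerA.
Qed.

Lemma row_combination_diag (F : d.-tuple V) (x : 'rV[Qp]_d) :
  row_combination F (diag_mx x) = [tuple x 0 i *: tnth F i | i < d].
Proof.
apply: eq_from_tnth => i; rewrite !tnth_mktuple (bigD1 i) //= big1 => [|j ji].
  by rewrite addr0 !mxE eqxx.
by rewrite !mxE eq_sym (negPf ji) scale0r.
Qed.

Lemma free_row_combination (F : d.-tuple V) (A : 'M[Qp]_d) :
  free F -> A \in unitmx -> free (row_combination F A).
Proof.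
move=> /freeP Ff AU; apply/freeP => k.
under eq_bigr do rewrite -tnth_nth tnth_mktuple scaler_sumr.
rewrite exchange_big /= => k0.
have kA0 : \row_i k i *m A = 0.
  apply/rowP => j; rewrite mxE [RHS]mxE; under eq_bigr do rewrite mxE.
  apply: (Ff (fun j => \sum_i k i * A i j)); rewrite -[RHS]k0.
  apply: eq_bigr => l _; rewrite scaler_suml -tnth_nth.
  by apply: eq_bigr => i _; rewrite scalerA.
move=> i; have /rowP/(_ i) : \row_i k i = 0.
  by rewrite -(mulmxK AU (\row_i k i)) kA0 mul0mx.
by rewrite !mxE.
Qed.

Lemma zp_span_coord (w : d.-tuple V) (x : 'I_d -> Qp) : free w ->
  zp_span w (\sum_i x i *: tnth w i) <-> forall i, integral (x i).
Proof.
move=> /freeP wf; split=> [[c _ cE] i|xi].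
  exists (c i); apply/esym/eqP; rewrite -subr_eq0; apply/eqP.
  apply: (wf (fun i => (c i)%:F - x i)).
  under eq_bigr do rewrite -tnth_nth scalerBl.
  by rewrite sumrB cE subrr.
apply: submodule_sum (zp_span_submodule w) _ => i.
by have [_ _] := zp_span_submodule w; apply=> //; apply: mem_zp_span.
Qed.

(** Containment of lattices given by bases, read off the coordinates C of one
    basis in the other. *)
Lemma scaled_sub_row_combination (w : d.-tuple V) (C : 'M[Qp]_d) (a : int) :
  free w -> scaled_sub (zp_span w) (zp_span (row_combination w C)) a <->
  forall i j, integral (p%:R ^ a * C i j).
Proof.
move=> wf.
have rowE i : p%:R ^ a *: tnth (row_combination w C) i
    = \sum_j (p%:R ^ a * C i j) *: tnth w j.
  by rewrite tnth_mktuple scaler_sumr; apply: eq_bigr => j _; rewrite scalerA.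
split=> [h i|h].
  by apply/(zp_span_coord _ wf); rewrite -rowE; apply/h/mem_zp_span.
apply: (zp_span_sub (L := [set v | zp_span w (p%:R ^ a *: v)])).
  exact/submodule_preim/zp_span_submodule.
by move=> i /=; rewrite rowE; apply/(zp_span_coord _ wf).
Qed.

Section MinValDet.
Variables A C : 'M[Qp]_d.
(* A choice f of d rows of A and C A gives the matrix M f *m A. *)
Let M (f : 'I_d -> 'I_(d + d)) : 'M[Qp]_d := rowsub f (col_mx 1%:M C).

Let val_det_rowsub (f : 'I_d -> 'I_(d + d)) :
  padic_val (\det (rowsub f (col_mx A (C *m A))))
  = (padic_val (\det (M f)) + padic_val (\det A))%E.
Proof.
have -> : rowsub f (col_mx A (C *m A)) = M f *m A.
  by rewrite /M mul_rowsub_mx mul_col_mx mul1mx.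
by rewrite det_mulmx padic_valM.
Qed.

Let M_A (f : 'I_d -> 'I_(d + d)) k (h : (f k < d)%N) i :
  M f k i = (f k == lshift d i)%:R.
Proof.
have fE : f k = lshift d (Ordinal h) by apply: val_inj.
by rewrite mxE fE col_mxEu mxE (inj_eq (@lshift_inj _ _)).
Qed.

(** Any d rows of A, in any order, are N A with N integral, and N = 1 occurs. *)
Lemma min_val_det_full : min_val_det A (C *m A) d = padic_val (\det A).
Proof.
apply/eqP; rewrite eq_le; apply/andP; split; last first.
  apply/bigmin_geP; split=> [|f /andP[_ fd]]; first exact: leey.
  rewrite val_det_rowsub leeDr //; apply/integral_val/integral_det => i j.
  have fi : (f i < d)%N.
    have : [set k | (f k < d)%N]%SET == [set: 'I_d]%SET.
      by rewrite eqEcard finset.subsetT cardsT card_ord (eqP fd) /=.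
    by move/eqP/setP/(_ i); rewrite !inE.
  rewrite M_A //; case: (_ == _); [exact: integral1|exact: integral0].
pose f : {ffun 'I_d -> 'I_(d + d)} := [ffun k => lshift d k].
apply: (bigmin_inf f).
  apply/andP; split.
    by apply/injectiveP=> i j; rewrite !ffunE => /lshift_inj.
  rewrite (_ : [set _ | _]%SET = [set: 'I_d]%SET) ?cardsT ?card_ord //.
  by apply/setP=> k; rewrite !inE ffunE /= ltn_ord.
rewrite (_ : rowsub f _ = A) //; apply/matrixP=> i j.
by rewrite mxE ffunE col_mxEu.
Qed.

(** Here c is the least valuation of an entry of C.  A matrix M f with a single
    row from C has determinant divisible by p^c; for the upper bound, replacing
    row j0 of the identity by row i0 of C yields the determinant C i0 j0. *)
Lemma min_val_det_exchange (c : int) i0 j0 : padic_val (C i0 j0) = c%:E ->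
  (forall i j, (c%:E <= padic_val (C i j))%E) ->
  min_val_det A (C *m A) d.-1 = (c%:E + padic_val (\det A))%E.
Proof.
move=> C0 Cmin; have d0 : (0 < d)%N by apply: leq_ltn_trans (ltn_ord i0).
apply/eqP; rewrite eq_le; apply/andP; split; last first.
  apply/bigmin_geP; split=> [|f /andP[_ fd]]; first exact: leey.
  rewrite val_det_rowsub leeD2r //.
  have /cards1P[k0 k0E] : #|~: [set k | (f k < d)%N]%SET| == 1%N.
    by rewrite cardsCs finset.setCK card_ord (eqP fd) -subn1 subKn.
  have fk k : (f k < d)%N = (k != k0).
    by have /setP/(_ k) := k0E; rewrite !inE => <-; rewrite negbK.
  (* Multiplying the row of M f that comes from C by p^(- c) makes the whole
     matrix integral. *)
  pose D := diag_mx (\row_k (if k == k0 then p%:R ^ (- c) else 1 : Qp)).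
  have detD : \det D = p%:R ^ (- c).
    rewrite det_diag (bigD1 k0) //= mxE eqxx big1 ?mulr1 // => k /negPf kk0.
    by rewrite mxE kk0.
  rewrite -[c]opprK -integral_expp_mul -detD -det_mulmx.
  apply: integral_det => i j; rewrite mul_diag_mx mxE [X in X * _]mxE.
  have [->|ik0] := eqVneq i k0; last first.
    rewrite mul1r M_A ?fk //.
    by case: (_ == _); [exact: integral1|exact: integral0].
  rewrite [M f k0 j]mxE.
  have : ~~ (f k0 < d)%N by rewrite fk eqxx.
  rewrite -(splitK (f k0)); case: (split (f k0)) => l /=.
    by rewrite ltn_ord.
  by move=> _; rewrite col_mxEd; apply/integral_expp_mul; rewrite opprK.
pose f : {ffun 'I_d -> 'I_(d + d)} :=
  [ffun k => if k == j0 then rshift d i0 else lshift d k].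
have fE k : (f k < d)%N = (k != j0).
  by rewrite ffunE; case: eqP => /= _; rewrite ?ltn_ord // ltnNge leq_addr.
apply: (bigmin_inf f).
  apply/andP; split.
    apply/injectiveP=> i j fij; have := fE i; rewrite fij fE; move: fij.
    rewrite !ffunE; case: eqVneq => [->|ij0]; case: eqVneq => [->|jj0] //.
    by move=> /lshift_inj.
  rewrite (_ : [set _ | _]%SET = [set~ j0]%SET).
    by rewrite cardsC1 card_ord.
  by apply/setP=> k; rewrite !inE fE.
rewrite val_det_rowsub leeD2r // -C0.
rewrite (expand_det_col _ j0) (bigD1 j0) //= big1 ?addr0; last first.
  move=> k kj0; rewrite M_A ?fE // ffunE (negPf kj0) (inj_eq (@lshift_inj _ _)).
  by rewrite (negPf kj0) mul0r.
rewrite /cofactor (_ : row' _ _ = 1%:M).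
  have -> : (-1) ^+ (j0 + j0) = 1 :> Qp by rewrite addnn -signr_odd odd_double.
  rewrite det1 !mulr1 mxE ffunE eqxx.
  by rewrite col_mxEd.
apply/matrixP=> i j; rewrite [LHS]mxE [LHS]mxE M_A; last first.
  by rewrite fE eq_sym neq_lift.
rewrite ffunE [lift _ _ == j0]eq_sym (negPf (neq_lift _ _)).
by rewrite (inj_eq (@lshift_inj _ _)) (inj_eq lift_inj) mxE eq_sym.
Qed.

(** In terms of lattices, k = D(L, K) for L and K generated by the rows of A and
    C A, by [scaled_sub_row_combination]. *)
Lemma min_val_det_diff : A \in unitmx -> C \in unitmx -> (0 < d)%N ->
  exists k : int,
  (min_val_det A (C *m A) d - min_val_det A (C *m A) d.-1)%E = k%:E /\
  forall a, (forall i j, integral (p%:R ^ a * C i j)) <-> k <= a.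
Proof.
move=> AU CU d0.
pose ij0 : 'I_d * 'I_d := (Ordinal d0, Ordinal d0).
pose v (ij : 'I_d * 'I_d) := padic_val (C ij.1 ij.2).
have [[i0 j0] _ /= vmin] := arg_minP (i0 := ij0) (P := predT) v isT.
have Cmin i j : (padic_val (C i0 j0) <= padic_val (C i j))%E.
  exact: (vmin (i, j)).
have /padic_val_fin[c cE] : C i0 j0 != 0.
  apply: contraTneq CU => C0; suff -> : C = 0.
    apply/negP => /mxrank_unit; rewrite mxrank0 => dE.
    by have := d0; rewrite -dE.
  apply/matrixP=> i j; rewrite mxE; apply/eqP.
  have := Cmin i j; rewrite C0 padic_val0 leye_eq; apply: contraLR.
  by case/padic_val_fin => k ->.
have [a0 a0E] := padic_val_fin (unitmx_det_neq0 AU).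
exists (- c); split.
  rewrite min_val_det_full (min_val_det_exchange cE) -?cE // cE a0E.
  by rewrite -[LHS]/((a0 - (c + a0))%:E); congr (_%:E); lia.
move=> a; split=> [/(_ i0 j0)/integral_expp_mul|ca i j].
  by rewrite cE lee_fin lerNl.
apply/integral_expp_mul; apply: le_trans (Cmin i j).
by rewrite cE lee_fin lerNl.
Qed.

End MinValDet.
End Determinants.

(** * Lattices in an apartment *)

Lemma unitmx_diag (k : fieldType) d (x : 'rV[k]_d) :
  (forall i, x 0 i != 0) -> diag_mx x \in unitmx.
Proof. by move=> x0; rewrite unitmxE unitfE det_diag; apply/prodf_neq0. Qed.

Section Apartment.
Variables (p : nat) (p_pr : prime p) (d : nat).
Local Notation Qp := (padic p_pr).
Local Notation V := 'rV[Qp]_d.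
Implicit Types e f : 'I_d -> int.
Variable w : d.-tuple V.
Hypothesis w_basis : basis_of fullv w.

(** The lattice spanned by the p^(e_i) w_i, as in [apartment]. *)
Definition apartment_lattice e : set V :=
  zp_span [tuple p%:R ^ e i *: tnth w i | i < d].

Lemma apartment_lattice_scale a e :
  lattice_scale (p%:R ^ a) (apartment_lattice e)
    = apartment_lattice (fun k => a + e k).
Proof.
rewrite /apartment_lattice lattice_scale_span; congr zp_span.
by apply: eq_from_tnth => i; rewrite !tnth_mktuple scale_exppD.
Qed.

Lemma is_lattice_apartment e : is_lattice (apartment_lattice e).
Proof.
exists d, [tuple p%:R ^ e i *: tnth w i | i < d]; split=> [//|].
apply/eqP; rewrite eqEsubv subvf -(span_basis w_basis).
apply/span_subvP => v /tnthP[i ->].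
rewrite -(scale_exppK (e i) (tnth w i)); apply/memvZ/memv_span.
by apply/tnthP; exists i; rewrite tnth_mktuple.
Qed.

Let powers e : 'rV[Qp]_d := \row_i p%:R ^ e i.

Let apartment_tuple e : d.-tuple V := [tuple p%:R ^ e i *: tnth w i | i < d].

Let apartment_tupleE e :
  apartment_tuple e = row_combination w (diag_mx (powers e)).
Proof.
rewrite row_combination_diag; apply: eq_from_tnth => i.
by rewrite !tnth_mktuple mxE.
Qed.

Let apartment_tupleD e g : apartment_tuple (fun i => g i + e i) =
  row_combination (apartment_tuple e) (diag_mx (powers g)).
Proof.
rewrite row_combination_diag; apply: eq_from_tnth => i.
by rewrite !tnth_mktuple scale_exppD mxE.
Qed.

Lemma scaled_sub_apartment e f a :
  scaled_sub (apartment_lattice e) (apartment_lattice f) a <->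
  forall k, e k <= a + f k.
Proof.
have pow_unit g : diag_mx (powers g) \in unitmx.
  by apply: unitmx_diag => i; rewrite mxE expp_neq0.
have -> : apartment_lattice f = zp_span
    (row_combination (apartment_tuple e)
       (diag_mx (powers (fun i => f i - e i)))).
  rewrite -apartment_tupleD; congr zp_span.
  by apply: eq_from_tnth => i; rewrite !tnth_mktuple subrK.
have ef : free (apartment_tuple e).
  rewrite apartment_tupleE.
  exact: free_row_combination (basis_free w_basis) (pow_unit e).
rewrite -/(apartment_tuple e) (scaled_sub_row_combination _ _ ef).
split=> [h k|h i j].
  have := h k k; rewrite !mxE eqxx mulr1n.
  rewrite -(expfzDr _ _ (padic_p_neq0 p_pr)) => /integral_expp; lia.
rewrite !mxE; case: eqP => [_|_]; last by rewrite mulr0; exact: integral0.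
rewrite mulr1n -(expfzDr _ _ (padic_p_neq0 p_pr)); apply/integral_expp.
by have := h i; lia.
Qed.

End Apartment.

(** * Sums of distances *)

Section DistanceSums.
Variables (p : nat) (p_pr : prime p) (d n : nat).
Local Notation Qp := (padic p_pr).
Local Notation V := 'rV[Qp]_d.
Hypothesis d_gt0 : (0 < d)%N.
Variables (alpha : 'I_n -> vertex p_pr d) (L : 'I_n -> set V).
Hypothesis LE : forall i, vertex_of (L i) (alpha i).

(** The sums of distances are natural numbers, so they attain their minimum. *)
Lemma graph_dist_sum_min : (0 < n)%N -> exists m : nat,
  is_minimum [set (\sum_(i < n) graph_dist (alpha i) beta)%E
             | beta in [set: vertex p_pr d]] m%:Z%:E.
Proof.
move=> n0; have distE (x y : vertex p_pr d) :
    exists m : nat, graph_dist x y = m%:Z%:E.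
  have [Lx xL] := vertex_has_lattice x; have [Ly yL] := vertex_has_lattice y.
  by have [m [mE _ _]] := graph_dist_within xL yL; exists m.
pose dist x y := projT1 (cid (distE x y)).
pose total beta := (\sum_(i < n) dist (alpha i) beta)%N.
have sumE beta : (\sum_(i < n) graph_dist (alpha i) beta)%E
    = (total beta)%:Z%:E.
  rewrite (big_morph Posz PoszD (erefl _)) -sumEFin; apply: eq_bigr => i _.
  by rewrite /dist; case: (cid _).
have exP : exists m, `[< exists beta, total beta = m >].
  by eexists; apply/asboolP; exists (alpha (Ordinal n0)).
case: (ex_minnP exP) => m /asboolP[beta betaE] mmin; exists m; split.
  by exists beta; rewrite ?sumE ?betaE.
move=> _ [gamma _ <-]; rewrite sumE lee_fin lez_nat; apply: mmin.
by apply/asboolP; exists gamma.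
Qed.

(* D i j is the least a such that p^a L_j is contained in L_i. *)
Variable D : 'I_n -> 'I_n -> int.
Hypothesis DP : forall i j a, scaled_sub (L i) (L j) a <-> D i j <= a.

Lemma sum_dist_ge beta (s : 'S_n) :
  ((\sum_(i < n) D i (s i))%:E <= \sum_(i < n) graph_dist (alpha i) beta)%E.
Proof.
have [K Kb] := vertex_has_lattice beta.
have h i : exists ab : int * int, [/\ scaled_sub (L i) K ab.1,
    scaled_sub K (L i) ab.2
    & ((ab.1 + ab.2)%:E <= graph_dist (alpha i) beta)%E].
  have [m [-> [a [b [aP bP abm]]] _]] := graph_dist_within (LE i) Kb.
  by exists (a, b); split; rewrite ?lee_fin.
pose ab i := projT1 (cid (h i)).
have abP i := projT2 (cid (h i)).
apply: (@le_trans _ _ (\sum_(i < n) ((ab i).1 + (ab i).2)%:E)%E); last first.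
  by apply: lee_sum => i _; have [] := abP i.
rewrite sumEFin lee_fin big_split /=.
rewrite [X in _ + X](reindex_inj (@perm_inj _ s)) -big_split /=.
apply: ler_sum => i _; apply/DP.
have [LK _ _] := abP i; have [_ KL _] := abP (s i).
exact: scaled_sub_trans LK KL.
Qed.

(** A suitable beta is found in the apartment of w itself: its exponents are
    f k = max_i (e i k - u i), for an optimal dual solution (u, v). *)
Lemma apartment_sum_dist_le (w : d.-tuple V) : basis_of fullv w ->
  (forall i, apartment w (alpha i)) -> exists beta (s : 'S_n),
  (\sum_(i < n) graph_dist (alpha i) beta <= (\sum_(i < n) D i (s i))%:E)%E.
Proof.
move=> wB aw.
have h i : exists e, L i = apartment_lattice w e.
  have [e ae] := aw i; have [a ->] := vertex_of_homothetic ae (LE i).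
  by eexists; apply: apartment_lattice_scale.
pose e i := projT1 (cid (h i)).
have eE i : L i = apartment_lattice w (e i) by exact: projT2 (cid (h i)).
have DE i j k : e i k <= D i j + e j k.
  by move: k; apply/(scaled_sub_apartment wB); rewrite -!eE; apply/DP.
have [u [v [s [uv sE]]]] := assignment_duality D.
(* f k = max_i (e i k - u i); the value is irrelevant when n = 0. *)
have fP k : exists f : int, forall i, f - e i k <= v i /\ e i k - f <= u i.
  have [[i0 _]|no] := pselect (exists i : 'I_n, True); last first.
    by exists 0 => i; case: no; exists i.
  have [i1 _ imax] :=
    arg_maxP (i0 := i0) (P := predT) (fun i => e i k - u i) isT.
  exists (e i1 k - u i1) => i; split; last by have := imax i isT; lia.
  by have := DE i1 i k; have := uv i1 i; lia.
pose f k := projT1 (cid (fP k)).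
have fE k i : f k - e i k <= v i /\ e i k - f k <= u i := projT2 (cid (fP k)) i.
have [beta bf] := vertex_of_exists (is_lattice_apartment wB f).
exists beta, s; rewrite -sE -sumEFin; apply: lee_sum => i _.
have [m [-> _ mmin]] := graph_dist_within (LE i) bf; rewrite lee_fin.
have uv0 : 0 <= u i + v i.
  apply: le_trans (uv i i); have := DE i i (Ordinal d_gt0); lia.
rewrite -(gez0_abs uv0) lez_nat; apply: mmin.
exists (u i), (v i); rewrite gez0_abs // eE; split=> //.
  by apply/(scaled_sub_apartment wB) => k; have [_] := fE k i; lia.
by apply/(scaled_sub_apartment wB) => k; have [] := fE k i; lia.
Qed.

End DistanceSums.

Theorem theorem2 (p : nat) (p_pr : prime p) (d : nat) (d_ge2 : (2 <= d)%N)
    (F : d.-tuple 'rV[padic p_pr]_d) (F_basis : basis_of fullv F)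
    (n : nat) (n_ge1 : (1 <= n)%N)
    (alpha : 'I_n -> vertex p_pr d) (A : 'I_n -> 'M[padic p_pr]_d)
    (A_GL : forall i, A i \in unitmx)
    (alphaE : forall i, matrix_vertex F (A i) (alpha i)) :
  exists M : \bar int,
    [/\ is_minimum [set (\sum_(i < n) graph_dist (alpha i) beta)%E
                   | beta in [set: vertex p_pr d]] M,
        (\big[Order.max/-oo]_(pi : 'S_n)
           \sum_(i < n) (min_val_det (A i) (A (pi i)) d
                         - min_val_det (A i) (A (pi i)) d.-1) <= M)%E
      & (exists2 w : d.-tuple 'rV[padic p_pr]_d,
           basis_of fullv w & forall i, apartment w (alpha i)) ->
        M = (\big[Order.max/-oo]_(pi : 'S_n)
           \sum_(i < n) (min_val_det (A i) (A (pi i)) d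
                         - min_val_det (A i) (A (pi i)) d.-1))%E].
Proof.
have d0 : (0 < d)%N by apply: ltnW.
pose L i := zp_span (row_combination F (A i)).
have D_ex i j : exists k : int,
    (min_val_det (A i) (A j) d - min_val_det (A i) (A j) d.-1)%E = k%:E /\
    forall a, scaled_sub (L i) (L j) a <-> k <= a.
  pose C := A j *m invmx (A i).
  have AjE : A j = C *m A i by rewrite /C mulmxKV.
  have CU : C \in unitmx by rewrite unitmx_mul A_GL unitmx_inv A_GL.
  have [k [kE kP]] := min_val_det_diff (A_GL i) CU d0.
  exists k; split; first by rewrite AjE.
  move=> a; rewrite -kP /L AjE -row_combinationM.
  apply: scaled_sub_row_combination.
  exact: free_row_combination (basis_free F_basis) (A_GL i).
pose D i j := projT1 (cid (D_ex i j)).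
have DE i j : (min_val_det (A i) (A j) d - min_val_det (A i) (A j) d.-1)%E
    = (D i j)%:E by have [] := projT2 (cid (D_ex i j)).
have DP i j a : scaled_sub (L i) (L j) a <-> D i j <= a.
  by have [_] := projT2 (cid (D_ex i j)).
have LE i : vertex_of (L i) (alpha i) by exact: alphaE.
under eq_bigr do under eq_bigr do rewrite DE.
under eq_bigr do rewrite sumEFin.
have [m [[beta _ betaE] mmin]] := graph_dist_sum_min alpha n_ge1.
have max_le : (\big[Order.max/-oo]_(s : 'S_n) (\sum_(i < n) D i (s i))%:E
    <= m%:Z%:E)%E.
  apply/bigmax_leP; split=> [|s _]; first exact: leNye.
  by rewrite -betaE; apply: sum_dist_ge.
exists m%:Z%:E; split=> //; first by split=> //; exists beta.
move=> [w wB aw]; apply/eqP; rewrite eq_le max_le andbT.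
have [gamma [s sle]] := apartment_sum_dist_le d0 LE DP wB aw.
apply: (bigmax_sup s) => //; apply: le_trans sle.
by apply: mmin; exists gamma.
Qed.
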